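(* Let $\mathcal{G}$, $p_{ij}$, $w_{ij}$ and $\epsilon>0$ be as in the context. The gossip algorithm achieves mean-square average consensus if and only if $1$ is a simple eigenvalue of the matrix $E[M\otimes M]:=\sum_{(j,i)\in\mathcal{E}}p_{ij}\,M_{ji}\otimes M_{ji}$ and all other eigenvalues of $E[M\otimes M]$ have modulus strictly smaller than one.
   Context: Setting: $\mathcal{G}=(\mathcal{V},\mathcal{E})$ is a digraph with $\mathcal{V}=\{1,\dots,n\}$, $n>1$, and no selfloops. To each edge $(j,i)\in\mathcal{E}$ are assigned a probability $p_{ij}\in(0,1)$, with $\sum_{(j,i)\in\mathcal{E}}p_{ij}=1$, and a weight $w_{ij}\in(0,1)$. Notation: $f_i$ is the $i$-th standard basis vector of $\mathbb{R}^n$, and $\otimes$ is the Kronecker product. For each edge $(j,i)$ let $D_{ji}=w_{ij}f_if_i^T$, $L_{ji}=D_{ji}-w_{ij}f_if_j^T$, $S_{ji}=I-(f_j-f_i)f_j^T$, and $$M_{ji}=\begin{bmatrix} I-L_{ji} & \epsilon D_{ji}\\ L_{ji} & S_{ji}-\epsilon D_{ji}\end{bmatrix}.$$ Gossip algorithm: $(x(k+1),s(k+1))^T=M(k)(x(k),s(k))^T$, where $M(k)$ are i.i.d. and $M(k)=M_{ji}$ with probability $p_{ij}$. The initial condition is $s(0)=0$ with $x(0)$ arbitrary. Mean-square average consensus: for every $x(0)$, $E[\|x(k)-x_a\mathbf{1}\|_2^2]\to0$ and $E[\|s(k)\|_2^2]\to0$, where $x_a=\mathbf{1}^Tx(0)/n$.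 *)

(* Defs.v *)
From HB Require Import structures.
From mathcomp Require Import all_boot all_order all_algebra.
From mathcomp Require Import all_classical all_reals topology normedtype sequences.
From mathcomp.real_closed Require Import complex mxtens.
Set Implicit Arguments. Unset Strict Implicit. Unset Printing Implicit Defensive.
Import Order.TTheory GRing.Theory Num.Theory numFieldNormedType.Exports.
Local Open Scope classical_set_scope.
Local Open Scope ring_scope.

(* Edges are pairs (j, i) : 'I_n * 'I_n, meaning an edge from j to i.
   p i j and w i j are the probability and weight of edge (j,i). *)
Section Gossip.
Variables (R : realType) (n : nat).
Variables (p w : 'I_n -> 'I_n -> R) (eps : R).

Definition Dmx (j i : 'I_n) : 'M[R]_n := w i j *: delta_mx i i.
Definition Lmx (j i : 'I_n) : 'M[R]_n := Dmx j i - w i j *: delta_mx i j.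
Definition Smx (j i : 'I_n) : 'M[R]_n :=
  1%:M - (delta_mx j j - delta_mx i j).
Definition Mmx (e : 'I_n * 'I_n) : 'M[R]_(n + n) :=
  let: (j, i) := e in
  block_mx (1%:M - Lmx j i) (eps *: Dmx j i)
           (Lmx j i)        (Smx j i - eps *: Dmx j i).

Definition EMkronM (E : {set 'I_n * 'I_n}) : 'M[R]_((n + n) * (n + n)) :=
  \sum_(e in E) p e.2 e.1 *: tensmx (Mmx e) (Mmx e).

Definition traj (t : seq ('I_n * 'I_n)) (z0 : 'cV[R]_(n + n)) : 'cV[R]_(n + n) :=
  foldl (fun z e => Mmx e *m z) z0 t.

(* expectation of F(z(k)) for i.i.d. M(k) with P(M(k) = M_ji) = p_ij *)
Definition expect (E : {set 'I_n * 'I_n}) (k : nat) (z0 : 'cV[R]_(n + n))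
  (F : 'cV[R]_(n + n) -> R) : R :=
  \sum_(t : k.-tuple ('I_n * 'I_n) | all (fun e => e \in E) t)
     (\prod_(e <- t) p e.2 e.1) * F (traj t z0).

Definition sqnorm m (v : 'cV[R]_m) : R := \sum_i v i 0 ^+ 2.

Definition xpart (z : 'cV[R]_(n + n)) : 'cV[R]_n := usubmx z.
Definition spart (z : 'cV[R]_(n + n)) : 'cV[R]_n := dsubmx z.

Definition ms_average_consensus (E : {set 'I_n * 'I_n}) : Prop :=
  forall x0 : 'cV[R]_n,
    let z0 := col_mx x0 0 in
    let xa := (\sum_i x0 i 0) / n%:R in
    ((fun k => expect E k z0 (fun z => sqnorm (xpart z - const_mx xa))) @ \oo --> (0:R))
    /\ ((fun k => expect E k z0 (fun z => sqnorm (spart z))) @ \oo --> (0:R)).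
End Gossip.

Definition simple_one_rest_in_disk (R : rcfType) m (A : 'M[R]_m) : Prop :=
  let Ac := map_mx (real_complex R) A in
  mup 1 (char_poly Ac) = 1%N /\
  forall lam : R[i], eigenvalue Ac lam -> lam != 1 -> `|lam| < 1.

(* Main.v *)
Require Import Defs.
From HB Require Import structures.
From mathcomp Require Import all_boot all_order all_algebra.
From mathcomp Require Import all_classical all_reals topology normedtype sequences.
From mathcomp.real_closed Require Import complex mxtens.
From mathcomp Require Import ring lra.
Import Order.TTheory GRing.Theory Num.Theory numFieldNormedType.Exports.
Import Normc.
Set Implicit Arguments. Unset Strict Implicit. Unset Printing Implicit Defensive.
Local Open Scope classical_set_scope.
Local Open Scope ring_scope.

(* Every M_ji fixes v = (1, 0) and preserves the total sum of the state, so
   A = E[M (x) M] fixes v (x) v on the right and the all-ones row on the left.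
   Removing this rank-one part gives B, whose spectrum is that of A with one
   eigenvalue 1 replaced by 0; the spectral condition on A thus says that the
   spectral radius of B is < 1, i.e. that B^k u -> 0 for every u.

   Since E[z(k) (x) y(k)] = A^k (z(0) (x) y(0)), and A and B agree on tensors of
   zero sum, this gives mean-square convergence of z - x_a v. Conversely,
   consensus makes E|z(k)|^2 -> 0 for every zero-sum z(0); AM-GM handles the
   tensors z (x) y and Jensen the tensors z (x) v, and with v (x) v, which B kills,
   these span everything. *)

(** * Deflation of a rank-one part and the characteristic polynomial *)

Lemma char_poly_rank1 (F : fieldType) m (r : 'cV[F]_m) (l : 'rV[F]_m) :
  l *m r = 1%:M -> 'X * char_poly (r *m l) = 'X^m * ('X - 1).
Proof.
move=> lr.
pose rp := map_mx polyC r; pose lp := map_mx polyC l.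
have lrp : lp *m rp = 1%:M by rewrite -map_mxM lr map_mx1.
(* The determinant of this bordered matrix is computed twice. Eliminating the corner 1 leaves the
   Schur complement 'X - r l; multiplying on the right by a matrix of determinant 'X clears the
   block [rp] and leaves 'X - l r = 'X - 1 in the corner. *)
pose K : 'M[{poly F}]_(1 + m) := block_mx 1%:M lp rp 'X%:M.
have dK1 : \det K = char_poly (r *m l).
  have -> : K = block_mx 1%:M 0 rp 1%:M *m
                block_mx 1%:M lp 0 (char_poly_mx (r *m l)).
    rewrite mulmx_block !mul1mx !mulmx1 !mulmx0 !mul0mx !addr0.
    by rewrite /char_poly_mx map_mxM addrC subrK.
  by rewrite det_mulmx det_lblock det_ublock !det1 !mul1r.
have : \det K * 'X = ('X - 1) * 'X^m.
  have dX : \det (block_mx 'X%:M 0 (- rp) 1%:M) = 'X.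
    by rewrite det_lblock det1 mulr1 det_scalar1.
  rewrite -[in LHS]dX -det_mulmx mulmx_block !mul1mx !mulmx1 !mulmx0 mulmxN lrp !add0r.
  rewrite mul_mx_scalar mulmxN mul_scalar_mx subrr det_ublock det_scalar.
  by rewrite det_mx11 !mxE eqxx.
by rewrite dK1 mulrC => ->; rewrite mulrC.
Qed.

(* B := A - r l kills r, hence 'X%:M *m ('X%:M - A) factors as
   ('X%:M - B) *m ('X%:M - r l). *)
Lemma char_poly_deflation (F : fieldType) m (A : 'M[F]_m) (r : 'cV[F]_m)
    (l : 'rV[F]_m) :
  A *m r = r -> l *m r = 1%:M ->
  'X * char_poly A = char_poly (A - r *m l) * ('X - 1).
Proof.
move=> Ar lr; set B := A - r *m l.
have Br : B *m r = 0 by rewrite mulmxBl Ar -mulmxA lr mulmx1 subrr.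
have key : 'X%:M *m char_poly_mx A = char_poly_mx B *m char_poly_mx (r *m l).
  rewrite /char_poly_mx mulmxBr mulmxBl.
  rewrite [_ *m ('X%:M - map_mx _ (r *m l))]mulmxBr.
  rewrite [map_mx polyC B *m _]mulmxBr -map_mxM mulmxA Br mul0mx map_mx0 subr0.
  rewrite /B map_mxB !mul_scalar_mx !mul_mx_scalar scalerBr.
  by rewrite -addrA opprB addKr.
(* The extra factor 'X turns [char_poly (r *m l)] into 'X^m * ('X - 1), after which 'X^m cancels. *)
have /(congr1 (fun M => 'X * \det M)) := key.
rewrite !det_mulmx det_scalar -!/(char_poly _) [RHS]mulrCA char_poly_rank1 //.
rewrite mulrCA [in RHS]mulrCA => /mulfI; apply.
by rewrite expf_neq0 // polyX_eq0.
Qed.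

Lemma normc_ge0 (R : rcfType) (z : R[i]) : 0 <= normc z.
Proof. by case: z => ? ?; exact: sqrtr_ge0. Qed.

Lemma normc_lt1 (R : rcfType) (z : R[i]) : (`|z| < 1) = (normc z < 1).
Proof. by rewrite -[1 in LHS]/(1%:C)%C; rewrite normc_def ltcR; case: z. Qed.

(** Deflation trades one eigenvalue 1 for an eigenvalue 0. So 1 is simple for A exactly when it is
    not an eigenvalue of the deflated matrix, and away from 0 and 1 the two spectra agree. *)
Lemma simple_one_deflation (R : rcfType) m (A : 'M[R]_m) (r : 'cV[R]_m)
    (l : 'rV[R]_m) :
  A *m r = r -> l *m r = 1%:M ->
  simple_one_rest_in_disk A <->
  (forall lam : R[i],
     eigenvalue (map_mx (real_complex R) (A - r *m l)) lam -> `|lam| < 1).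
Proof.
move=> Ar lr; rewrite /simple_one_rest_in_disk map_mxB map_mxM.
set f := real_complex R.
set Ac := map_mx f A; set rc := map_mx f r; set lc := map_mx f l.
have Acr : Ac *m rc = rc by rewrite -map_mxM Ar.
have lcr : lc *m rc = 1%:M by rewrite -map_mxM lr map_mx1.
have E := char_poly_deflation Acr lcr.
set B := Ac - rc *m lc in E *.
have nz M : char_poly M != 0 :> {poly R[i]} by rewrite monic_neq0 ?char_poly_monic.
have rX1 : root ('X : {poly R[i]}) 1 = false by rewrite /root hornerX oner_eq0.
have E1 : mup 1 (char_poly Ac) = (mup 1 (char_poly B)).+1.
  have := congr1 (mup 1) E.
  have nX1 : 'X - 1 != 0 :> {poly R[i]} by rewrite -polyC1 polyXsubC_eq0.
  rewrite mupMr ?rX1 // mupM // => ->.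
  by rewrite -['X - 1]expr1 -polyC1 mup_XsubCX eqxx addn1.
have Er lam : (lam == 0) || root (char_poly Ac) lam = root (char_poly B) lam || (lam == 1).
  have := congr1 (fun q => root q lam) E.
  by rewrite !rootM -polyC1 root_XsubC /root hornerX.
split=> [[m1 H] lam|H].
  rewrite eigenvalue_root_char => rB.
  have [l1|l1] := eqVneq lam 1.
    have : mup 1 (char_poly B) = 0%N by move: m1; rewrite E1 => -[].
    by move/eqP; rewrite -leqn0 leqNgt -XsubC_dvd // dvdp_XsubCl -l1 rB.
  have [->|l0] := eqVneq lam 0; first by rewrite normr0 ltr01.
  apply: H => //; rewrite eigenvalue_root_char.
  by have := Er lam; rewrite (negPf l0) (negPf l1) rB.
split.
  rewrite E1 mupNroot // -eigenvalue_root_char; apply/negP => /H.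
  by rewrite normr1 ltxx.
move=> lam; rewrite eigenvalue_root_char => rA l1; apply: H.
rewrite eigenvalue_root_char; have := Er lam.
by rewrite rA orbT (negPf l1) orbF => <-.
Qed.

(** * Spectral radius below one and decay of matrix iterates *)

Definition geometric_decay {R : realFieldType} (a : nat -> R) :=
  exists C q : R, [/\ 0 <= C, 0 <= q < 1 & forall k, a k <= C * q ^+ k].

(** When the rate of b equals rho, resonance produces a factor k; a rate strictly above both absorbs
    it. *)
Lemma geometric_decay_rec (R : realFieldType) (a b : nat -> R) (rho : R) :
  0 <= rho < 1 -> geometric_decay b ->
  (forall k, a k.+1 <= rho * a k + b k) -> geometric_decay a.
Proof.
move=> /andP[r0 r1] [C [q [C0 /andP[q0 q1] bC]]] rec.
(* Midpoint between the larger rate and 1. *)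
pose s := (Num.max rho q + 1) / 2.
have mq : q <= Num.max rho q by rewrite le_max lexx orbT.
have mr : rho <= Num.max rho q by rewrite le_max lexx.
have m1 : Num.max rho q < 1 by rewrite gt_max r1.
have [s0 qs rs s1] : [/\ 0 < s, q <= s, rho < s & s < 1].
  by rewrite /s; split; lra.
have sr : 0 < s - rho by rewrite subr_gt0.
(* The first summand gives C <= C' * (s - rho), which closes the induction step; the second covers k
   = 0. *)
pose C' := C / (s - rho) + `|a 0%N|.
have C'0 : 0 <= C' by rewrite addr_ge0 // divr_ge0 // ltW.
exists C', s; split=> //; first by rewrite (ltW s0).
elim=> [|k IH].
  rewrite expr0 mulr1 /C'.
  by apply: (le_trans (ler_norm _)); rewrite lerDr divr_ge0 // ltW.
apply: (le_trans (rec k)).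
have h1 : C <= C' * (s - rho).
  by rewrite /C' mulrDl divfK ?gt_eqF // lerDl mulr_ge0 // ltW.
have qk : q ^+ k <= s ^+ k by rewrite lerXn2r // nnegrE // ltW.
have sk : 0 <= s ^+ k by rewrite exprn_ge0 // ltW.
have h2 : C * q ^+ k <= C * s ^+ k by rewrite ler_wpM2l.
have h3 : C * s ^+ k <= C' * (s - rho) * s ^+ k by rewrite ler_wpM2r.
have h4 : rho * a k <= rho * (C' * s ^+ k) by rewrite ler_wpM2l.
have := bC k; rewrite exprS; lra.
Qed.

(* Peeling off one root z: u(k+1) = z u(k) + (B^k (B - z) u), where the last term
   decays by induction. *)
Lemma geometric_decay_iter_roots (R : rcfType) m (B : 'M[R[i]]_m.+1)
    (rs : seq R[i]) (u : 'cV[R[i]]_m.+1) :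
  {in rs, forall z, `|z| < 1} ->
  horner_mx B (\prod_(z <- rs) ('X - z%:P)) *m u = 0 ->
  forall i, geometric_decay (fun k => normc (iter k (mulmx B) u i 0)).
Proof.
elim: rs u => [|z rs IH] u hrs.
  rewrite big_nil rmorph1 mul1mx => -> i; exists 0, 0; split=> // [|k].
    by rewrite lexx ltr01.
  suff -> : iter k (mulmx B) (0 : 'cV[R[i]]_m.+1) = 0 by rewrite mxE normc0 mul0r.
  by elim: k => //= k ->; rewrite mulmx0.
(* The factor B - z is moved next to u, so that the induction hypothesis applies to (B - z) u. *)
rewrite big_cons mulrC rmorphM /= rmorphB /= horner_mx_X horner_mx_C -mulmxA => h i.
have h' x : x \in rs -> `|x| < 1 by move=> xs; apply: hrs; rewrite inE xs orbT.
have /(_ i) dec := IH _ h' h.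
apply: (geometric_decay_rec (rho := normc z)) dec _.
  by rewrite normc_ge0 -normc_lt1 hrs ?mem_head.
move=> k.
have -> : iter k.+1 (mulmx B) u = z *: iter k (mulmx B) u
            + iter k (mulmx B) ((B - z%:M) *m u).
  elim: k => [|k IHk]; first by rewrite /= mulmxBl mul_scalar_mx addrC subrK.
  by rewrite iterS [in LHS]IHk mulmxDr -scalemxAr.
rewrite mxE [X in normc (X + _)]mxE.
by apply: (le_trans (le_normcD _ _)); rewrite normcM.
Qed.

(** Over a closed field the characteristic polynomial splits, and by Cayley-Hamilton its product of
    linear factors annihilates every u; this replaces the Jordan form. *)
Lemma geometric_decay_iter (R : rcfType) m (B : 'M[R[i]]_m) (u : 'cV[R[i]]_m) :
  (forall lam, eigenvalue B lam -> `|lam| < 1) ->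
  forall i, geometric_decay (fun k => normc (iter k (mulmx B) u i 0)).
Proof.
case: m B u => [|m] B u H; first by case.
have [rs E] := closed_field_poly_normal (char_poly B).
move: E; rewrite (monicP (char_poly_monic B)) scale1r => E.
apply: (@geometric_decay_iter_roots _ _ _ rs).
  by move=> z zrs; apply: H; rewrite eigenvalue_root_char E root_prod_XsubC.
by rewrite -E Cayley_Hamilton mul0mx.
Qed.

Lemma map_mx_iter (R S : pzRingType) (f : {rmorphism R -> S}) m (B : 'M[R]_m)
    (u : 'cV[R]_m) k :
  map_mx f (iter k (mulmx B) u) = iter k (mulmx (map_mx f B)) (map_mx f u).
Proof. by elim: k => //= k <-; rewrite map_mxM. Qed.

Lemma normc_real (R : rcfType) (x : R) : normc (x%:C)%C = `|x|.
Proof. by rewrite /= expr0n addr0 sqrtr_sqr. Qed.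

Lemma cvg0_le (R : realType) (a b : nat -> R) :
  (forall k, `|a k| <= b k) -> b @ \oo --> (0 : R) -> a @ \oo --> (0 : R).
Proof.
move=> ab b0; apply/norm_cvg0P.
apply: (@squeeze_cvgr _ _ _ _ (fun=> 0) b) => //; last exact: cvg_cst.
by apply: nearW => k; rewrite normr_ge0 ab.
Qed.

Lemma cvg0_sum (R : realType) (I : Type) (s : seq I) (f : I -> nat -> R) :
  (forall i, f i @ \oo --> (0 : R)) ->
  (fun k => \sum_(i <- s) f i k) @ \oo --> (0 : R).
Proof.
move=> f0; elim: s => [|i s IH].
  by under eq_fun do rewrite big_nil; exact: cvg_cst.
under eq_fun do rewrite big_cons.
by have := cvgD (f0 i) IH; rewrite addr0; apply.
Qed.

Lemma cvg0Ml (R : realType) (c : R) (a : nat -> R) :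
  a @ \oo --> (0 : R) -> (fun k => c * a k) @ \oo --> (0 : R).
Proof. by move=> a0; have := cvgMl_tmp (a := c) a0; rewrite mulr0; apply. Qed.

Lemma geometric_decay_cvg (R : realType) (a : nat -> R) :
  geometric_decay (fun k => `|a k|) -> a @ \oo --> (0 : R).
Proof.
move=> [C [q [_ /andP[q0 q1] aC]]]; apply: cvg0_le aC _.
by apply: cvg_geometric; rewrite ger0_norm.
Qed.

(** For the converse, a left eigenvector u with nonzero entry c makes lam^k * u_c a fixed complex
    combination of the real entries of B^k f_c. If |lam| >= 1, this cannot tend to 0. *)
Lemma spectral_radius_lt1P (R : realType) m (B : 'M[R]_m) :
  (forall lam, eigenvalue (map_mx (real_complex R) B) lam -> `|lam| < 1) <->
  (forall (u : 'cV[R]_m) i,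
     (fun k => iter k (mulmx B) u i 0) @ \oo --> (0 : R)).
Proof.
split=> [H u i|H lam].
  apply: geometric_decay_cvg.
  have := geometric_decay_iter (map_mx (real_complex R) u) H i.
  have E k : normc (iter k (mulmx (map_mx (real_complex R) B))
      (map_mx (real_complex R) u) i 0) = `|iter k (mulmx B) u i 0|.
    by rewrite -map_mx_iter mxE normc_real.
  by under eq_fun do rewrite E.
case/eigenvalueP => u uB u0; rewrite normc_lt1 ltNge; apply/negP => lam1.
have [c uc] : exists c, u 0 c != 0.
  apply/existsP; apply: contraNT u0; rewrite negb_exists => /forallP h.
  by apply/eqP/rowP => c; rewrite mxE; have := h c; rewrite negbK => /eqP.
pose e : 'cV[R]_m := delta_mx c 0.
have E k : lam ^+ k * u 0 c =
    \sum_d u 0 d * (iter k (mulmx B) e d 0)%:C%C.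
  have -> : \sum_d u 0 d * (iter k (mulmx B) e d 0)%:C%C =
      (u *m map_mx (real_complex R) (iter k (mulmx B) e)) 0 0.
    by rewrite mxE; apply: eq_bigr => d _; rewrite mxE.
  rewrite map_mx_iter; elim: k => [|k IH] /=.
    rewrite mul1r mxE (bigD1 c) //= big1 => [|d dc].
      by rewrite !mxE !eqxx mulr1 addr0.
    by rewrite !mxE (negPf dc) /= mulr0.
  by rewrite mulmxA uB -scalemxAl mxE -IH exprS mulrA.
have nuc : 0 < normc (u 0 c).
  rewrite lt_neqAle eq_sym normc_ge0 andbT.
  by apply: contra uc => /eqP/eq0_normc ->.
(* This real sequence dominates |lam^k * u_c| by the triangle inequality, so it should fall below
   |u_c| yet never does. *)
have : (fun k => \sum_d normc (u 0 d) * `|iter k (mulmx B) e d 0|) @ \oo --> (0 : R).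
  by apply: cvg0_sum => d; apply: cvg0Ml; apply/norm_cvg0P; exact: H.
move/cvgr0Pnorm_lt => /(_ _ nuc) [N _ /(_ N (leqnn N))] /=.
rewrite ger0_norm; last first.
  by apply: sumr_ge0 => d _; rewrite mulr_ge0 // normc_ge0.
apply/negP; rewrite -leNgt.
apply: (@le_trans _ _ (normc (lam ^+ N * u 0 c))).
  rewrite normcM ler_peMl ?(ltW nuc) //.
  elim: (N) => [|k IH]; first by rewrite expr0 normc1.
  by rewrite exprS normcM; apply: mulr_ege1.
rewrite E; elim/big_ind2: _ => [|x1 x2 y1 y2 h1 h2|d _].
- by rewrite normc0.
- by apply: (le_trans (le_normcD _ _)); rewrite lerD.
- by rewrite normcM normc_real.
Qed.

Lemma iter_mulmx (R : pzRingType) m (A : 'M[R]_m) (u : 'cV[R]_m) k :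
  iter k (mulmx A) u = A ^+ k *m u.
Proof.
elim: k => [|k IH] /=; first by rewrite expr0 mul1mx.
by rewrite IH exprS mulmxA.
Qed.

(** * Kronecker products of columns *)

Section TensorColumn.
Variable R : comPzRingType.

(** The Kronecker product of two columns, with the row indexing of [*t]. *)
Definition tens_col m (z y : 'cV[R]_m) : 'cV[R]_(m * m) :=
  \col_k (z (mxtens_unindex k).1 0 * y (mxtens_unindex k).2 0).

Lemma tens_colE m (z y : 'cV[R]_m) a b :
  tens_col z y (mxtens_index (a, b)) 0 = z a 0 * y b 0.
Proof. by rewrite mxE mxtens_indexK. Qed.

Lemma tensmx_mul_col m (M N : 'M[R]_m) (z y : 'cV[R]_m) :
  (M *t N) *m tens_col z y = tens_col (M *m z) (N *m y).
Proof.
apply/colP => k; rewrite !mxE mulr_sum; apply: eq_bigr => i _.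
by rewrite !mxE mulrACA.
Qed.

Lemma mul_ones_tens_col m (z y : 'cV[R]_m) :
  const_mx 1 *m tens_col z y = ((\sum_i z i 0) * (\sum_i y i 0))%:M.
Proof.
apply/matrixP => i j; rewrite !ord1 !mxE eqxx mulr_sum.
by apply: eq_bigr => k _; rewrite !mxE mul1r.
Qed.

Lemma tens_colDl m (z1 z2 y : 'cV[R]_m) :
  tens_col (z1 + z2) y = tens_col z1 y + tens_col z2 y.
Proof. by apply/colP => k; rewrite !mxE mulrDl. Qed.

Lemma tens_colDr m (z y1 y2 : 'cV[R]_m) :
  tens_col z (y1 + y2) = tens_col z y1 + tens_col z y2.
Proof. by apply/colP => k; rewrite !mxE mulrDr. Qed.

Lemma tens_colZl m c (z y : 'cV[R]_m) : tens_col (c *: z) y = c *: tens_col z y.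
Proof. by apply/colP => k; rewrite !mxE mulrA. Qed.

Lemma tens_colZr m c (z y : 'cV[R]_m) : tens_col z (c *: y) = c *: tens_col z y.
Proof. by apply/colP => k; rewrite !mxE mulrCA. Qed.

Lemma mul_ones_tensmx m (M N : 'M[R]_m) :
  const_mx 1 *m M = const_mx 1 :> 'rV[R]_m ->
  const_mx 1 *m N = const_mx 1 :> 'rV[R]_m ->
  const_mx 1 *m (M *t N) = const_mx 1 :> 'rV[R]_(m * m).
Proof.
have S (K : 'M[R]_m) : const_mx 1 *m K = const_mx 1 :> 'rV[R]_m ->
    forall b, \sum_a K a b = 1.
  move=> /rowP H b; have := H b; rewrite !mxE => <-.
  by apply: eq_bigr => a _; rewrite mxE mul1r.
move=> /S HM /S HN; apply/rowP => k; rewrite !mxE.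
transitivity ((\sum_a M a (mxtens_unindex k).1) *
              (\sum_a N a (mxtens_unindex k).2)); last by rewrite HM HN mulr1.
by rewrite mulr_sum; apply: eq_bigr => i _; rewrite !mxE mul1r.
Qed.

Lemma delta_mx_mul_col m (i j : 'I_m) (x : 'cV[R]_m) :
  delta_mx i j *m x = x j 0 *: delta_mx i 0.
Proof.
apply/colP => a; rewrite !mxE (bigD1 j) //= big1 => [|b bj].
  by rewrite !mxE !eqxx !andbT addr0 mulrC.
by rewrite mxE (negPf bj) andbF mul0r.
Qed.

Lemma mul_ones_delta_mx m (i j : 'I_m) :
  const_mx 1 *m delta_mx i j = delta_mx 0 j :> 'rV[R]_m.
Proof.
apply/rowP => a; rewrite !mxE (bigD1 i) //= big1 => [|b bi].
  by rewrite !mxE !eqxx addr0 mul1r.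
by rewrite !mxE (negPf bi) mulr0.
Qed.

End TensorColumn.

(** * Expectation over random edge sequences *)

Section Expectation.
Variables (R : realType) (n : nat) (p : 'I_n -> 'I_n -> R).
Variable E : {set 'I_n * 'I_n}.

(* [expect] for functions of the whole history: cross moments of two
   trajectories driven by the same random edges are of this form only. *)
Definition hexpect k (G : seq ('I_n * 'I_n) -> R) : R :=
  \sum_(t : k.-tuple ('I_n * 'I_n) | all (fun e => e \in E) t)
     (\prod_(e <- t) p e.2 e.1) * G t.

Lemma hexpect0 G : hexpect 0 G = G [::].
Proof.
rewrite /hexpect (bigD1 [tuple]) //= big_nil mul1r big1 ?addr0 // => t.
by case/andP => _ /negP[]; rewrite [t]tuple0.
Qed.

(** Conditioning on the first edge, which is also the one that [traj] applies first. *)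
Lemma hexpectS k G :
  hexpect k.+1 G = \sum_(e in E) p e.2 e.1 * hexpect k (fun t => G (e :: t)).
Proof.
rewrite /hexpect (reindex (fun et : ('I_n * 'I_n) * k.-tuple ('I_n * 'I_n) =>
  [tuple of et.1 :: et.2])) /=; last first.
  exists (fun t => (thead t, [tuple of behead t])) => [[e t] _|t _] /=.
    by congr (_, _); apply: val_inj.
  by rewrite -tuple_eta.
rewrite -(pair_big (fun e => e \in E)
  (fun t : k.-tuple ('I_n * 'I_n) => all (fun e => e \in E) t)
  (fun e (t : k.-tuple ('I_n * 'I_n)) =>
     (\prod_(f <- e :: t) p f.2 f.1) * G (e :: t))) /=.
apply: eq_bigr => e _; rewrite big_distrr /=.
by apply: eq_bigr => t _; rewrite big_cons mulrA.
Qed.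

Lemma eq_hexpect k G1 G2 : G1 =1 G2 -> hexpect k G1 = hexpect k G2.
Proof. by move=> G12; apply: eq_bigr => t _; rewrite G12. Qed.

Lemma hexpectD k G1 G2 :
  hexpect k (fun t => G1 t + G2 t) = hexpect k G1 + hexpect k G2.
Proof. by rewrite -big_split; apply: eq_bigr => t _; rewrite mulrDr. Qed.

Lemma hexpectZ k c G : hexpect k (fun t => c * G t) = c * hexpect k G.
Proof. by rewrite big_distrr; apply: eq_bigr => t _; rewrite mulrCA. Qed.

Lemma hexpect_sum k (I : finType) (G : I -> seq ('I_n * 'I_n) -> R) :
  hexpect k (fun t => \sum_i G i t) = \sum_i hexpect k (G i).
Proof. by rewrite exchange_big; apply: eq_bigr => t _; rewrite big_distrr. Qed.

Hypothesis p_pos : forall e, e \in E -> 0 < p e.2 e.1 < 1.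
Hypothesis p_sum : \sum_(e in E) p e.2 e.1 = 1.

Lemma hexpect_le k G1 G2 :
  (forall t, all (fun e => e \in E) t -> G1 t <= G2 t) ->
  hexpect k G1 <= hexpect k G2.
Proof.
move=> G12; apply: ler_sum => t tE; rewrite ler_wpM2l ?G12 //.
rewrite big_seq prodr_ge0 // => e /(allP tE) /p_pos /andP[/ltW //].
Qed.

Lemma hexpect_ge0 k G : (forall t, 0 <= G t) -> 0 <= hexpect k G.
Proof.
move=> G0; have <- : hexpect k (fun=> 0) = 0 by apply: big1 => t _; rewrite mulr0.
by apply: hexpect_le => t _.
Qed.

Lemma hexpect_cst k c : hexpect k (fun=> c) = c.
Proof.
elim: k => [|k IH]; first by rewrite hexpect0.
rewrite hexpectS -[RHS]mul1r -p_sum big_distrl /=.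
by apply: eq_bigr => e _; rewrite IH.
Qed.

(** The variance of G is nonnegative. *)
Lemma sqr_hexpect_le k G : hexpect k G ^+ 2 <= hexpect k (fun t => G t ^+ 2).
Proof.
set m := hexpect k G.
have : 0 <= hexpect k (fun t => (G t - m) ^+ 2).
  by apply: hexpect_ge0 => t; exact: sqr_ge0.
rewrite (@eq_hexpect _ _ (fun t => G t ^+ 2 + ((- (2 * m)) * G t + m ^+ 2))).
  by rewrite hexpectD hexpectD hexpectZ hexpect_cst -/m; lra.
by move=> t; ring.
Qed.

End Expectation.

(** * Invariant vectors of the gossip matrices and second moments of the state *)

Section Gossip.
Variables (R : realType) (n : nat) (E : {set 'I_n * 'I_n}).
Variables (p w : 'I_n -> 'I_n -> R) (eps : R).

Local Notation M := (Mmx w eps).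
Local Notation A := (EMkronM p w eps E).
Local Notation traj := (traj w eps).
Local Notation hexpect := (hexpect p E).
Local Notation ones := (const_mx 1).

Definition consensus_dir : 'cV[R]_(n + n) := col_mx ones 0.
Local Notation v := consensus_dir.

Lemma Dmx_mul_col (j i : 'I_n) (x : 'cV[R]_n) :
  Dmx w j i *m x = (w i j * x i 0) *: delta_mx i 0.
Proof. by rewrite -scalemxAl delta_mx_mul_col scalerA. Qed.

Lemma Lmx_mul_col (j i : 'I_n) (x : 'cV[R]_n) :
  Lmx w j i *m x = (w i j * (x i 0 - x j 0)) *: delta_mx i 0.
Proof.
rewrite mulmxBl Dmx_mul_col -scalemxAl delta_mx_mul_col scalerA.
by rewrite -scalerBl mulrBr.
Qed.

Lemma Mmx_mul_col e (x s : 'cV[R]_n) :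
  M e *m col_mx x s =
  col_mx (x - Lmx w e.1 e.2 *m x + eps *: (Dmx w e.1 e.2 *m s))
         (Lmx w e.1 e.2 *m x + (Smx R e.1 e.2 - eps *: Dmx w e.1 e.2) *m s).
Proof. by case: e => j i; rewrite mul_block_col mulmxBl mul1mx -scalemxAl. Qed.

Lemma Mmx_consensus e : M e *m v = v.
Proof.
rewrite Mmx_mul_col Lmx_mul_col !mulmx0 !mxE subrr mulr0 !scale0r scaler0.
by rewrite subr0 !addr0.
Qed.

(** In each block column the L and D terms cancel, and [Smx] only moves the surplus of j to i. *)
Lemma mul_ones_Mmx e : ones *m M e = ones :> 'rV_(n + n).
Proof.
case: e => j i; rewrite -row_mx_const mul_row_block -!mulmxDr.
rewrite subrK mulmx1 addrC subrK /Smx mulmxBr mulmx1 mulmxBr.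
by rewrite !mul_ones_delta_mx subrr subr0.
Qed.

Lemma mul_ones_EMkronM : \sum_(e in E) p e.2 e.1 = 1 ->
  ones *m A = ones :> 'rV_((n + n) * (n + n)).
Proof.
move=> p1; rewrite mulmx_sumr -[RHS]scale1r -[X in _ = X *: _]p1 scaler_suml.
apply: eq_bigr => e _; rewrite -scalemxAr mul_ones_tensmx //; exact: mul_ones_Mmx.
Qed.

Lemma EMkronM_mul_col z y :
  A *m tens_col z y = \sum_(e in E) p e.2 e.1 *: tens_col (M e *m z) (M e *m y).
Proof.
rewrite mulmx_suml; apply: eq_bigr => e _.
by rewrite -scalemxAl tensmx_mul_col.
Qed.

Lemma EMkronM_consensus : \sum_(e in E) p e.2 e.1 = 1 ->
  A *m tens_col v v = tens_col v v.
Proof.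
move=> p1; rewrite EMkronM_mul_col -[RHS]scale1r -[X in _ = X *: _]p1 scaler_suml.
by apply: eq_bigr => e _; rewrite !Mmx_consensus.
Qed.

Lemma sum_consensus_dir : \sum_i v i 0 = n%:R.
Proof.
rewrite big_split_ord /= [X in _ + X]big1 => [|i _]; last by rewrite col_mxEd mxE.
under eq_bigr do rewrite col_mxEu mxE.
by rewrite sumr_const card_ord addr0.
Qed.

Lemma sum_sub_consensus (z : 'cV[R]_(n + n)) c :
  \sum_i (z - c *: v) i 0 = \sum_i z i 0 - c * n%:R.
Proof.
rewrite -sum_consensus_dir mulr_sumr -sumrB.
by apply: eq_bigr => i _; rewrite !mxE.
Qed.

Lemma trajD t z y : traj t (z + y) = traj t z + traj t y.
Proof. by elim: t z y => //= e t IH z y; rewrite mulmxDr IH. Qed.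

Lemma trajZ t c z : traj t (c *: z) = c *: traj t z.
Proof. by elim: t z => //= e t IH z; rewrite -scalemxAr IH. Qed.

Lemma traj_consensus t : traj t v = v.
Proof. by elim: t => //= e t IH; rewrite Mmx_consensus. Qed.

Lemma expectE k z F : expect p w eps E k z F = hexpect k (fun t => F (traj t z)).
Proof. by []. Qed.

(** A first edge e replaces z and y by M e z and M e y, hence the induction with z and y general;
    linearity of A^k collects the average over e. *)
Lemma second_moment k z y a b :
  hexpect k (fun t => traj t z a 0 * traj t y b 0) =
  iter k (mulmx A) (tens_col z y) (mxtens_index (a, b)) 0.
Proof.
elim: k z y => [|k IH] z y; first by rewrite hexpect0 tens_colE.
rewrite hexpectS iterSr EMkronM_mul_col iter_mulmx mulmx_sumr summxE.
by apply: eq_bigr => e _; rewrite -scalemxAr [RHS]mxE IH iter_mulmx.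
Qed.

(** The entries of v (x) v sum to n^2, so the scalar normalizes the right eigenvector to pair to 1
    with the all-ones row. *)
Definition deflated : 'M[R]_((n + n) * (n + n)) :=
  A - (n%:R ^- 2 *: tens_col v v) *m ones.
Local Notation B := deflated.

(** Zero total sum is preserved by A, and on such vectors the rank-one correction vanishes. *)
Lemma iter_deflated k (u : 'cV[R]_((n + n) * (n + n))) :
  \sum_(e in E) p e.2 e.1 = 1 ->
  ones *m u = 0 :> 'M_1 -> iter k (mulmx B) u = iter k (mulmx A) u.
Proof.
move=> p1 u0.
have uk j : ones *m iter j (mulmx A) u = 0 :> 'M_1.
  by elim: j => //= j IH; rewrite mulmxA mul_ones_EMkronM.
by elim: k => //= k ->; rewrite mulmxBl -mulmxA uk mulmx0 subr0.
Qed.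

Lemma simple_one_iter_deflated : (0 < n)%N -> \sum_(e in E) p e.2 e.1 = 1 ->
  simple_one_rest_in_disk A <->
  forall (u : 'cV[R]_((n + n) * (n + n))) i,
    (fun k => iter k (mulmx B) u i 0) @ \oo --> (0 : R).
Proof.
move=> n0 p1; rewrite -spectral_radius_lt1P; apply: simple_one_deflation.
  by rewrite -scalemxAr EMkronM_consensus.
rewrite -scalemxAr mul_ones_tens_col sum_consensus_dir scale_scalar_mx.
by rewrite -expr2 mulVf // sqrf_eq0 pnatr_eq0 -lt0n.
Qed.

(** The total sum of z (x) y is the product of the two sums, so one zero-sum factor is enough. *)
Lemma iter_deflated_hexpect k (z y : 'cV[R]_(n + n)) a b :
  \sum_(e in E) p e.2 e.1 = 1 ->
  \sum_i z i 0 = 0 \/ \sum_i y i 0 = 0 ->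
  iter k (mulmx B) (tens_col z y) (mxtens_index (a, b)) 0 =
  hexpect k (fun t => traj t z a 0 * traj t y b 0).
Proof.
move=> p1 zy; rewrite second_moment iter_deflated // mul_ones_tens_col.
by case: zy => ->; rewrite ?mul0r ?mulr0 raddf0.
Qed.

(** * From the spectral condition to consensus *)

Lemma spectrum_consensus : (0 < n)%N -> \sum_(e in E) p e.2 e.1 = 1 ->
  simple_one_rest_in_disk A -> ms_average_consensus p w eps E.
Proof.
move=> n0 p1 /(simple_one_iter_deflated n0 p1) H x0 z0 xa.
have nz : n%:R != 0 :> R by rewrite pnatr_eq0 -lt0n.
pose h := z0 - xa *: v.
have h0 : \sum_i h i 0 = 0.
  rewrite sum_sub_consensus big_split_ord /=.
  rewrite [X in _ + X - _]big1 => [|i _]; last by rewrite col_mxEd mxE.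
  under eq_bigr do rewrite col_mxEu.
  by rewrite /xa divfK // addr0 subrr.
have xav : xa *: v = col_mx (const_mx xa) 0.
  rewrite scale_col_mx scaler0; congr col_mx.
  by apply/colP => i; rewrite !mxE mulr1.
(* Since v is fixed by every edge, the deviation from consensus is itself the trajectory started at
   h. *)
have trh t : traj t z0 = traj t h + xa *: v.
  by rewrite -{1}[z0](subrK (xa *: v)) trajD trajZ traj_consensus.
have null a : (fun k => hexpect k (fun t => traj t h a 0 ^+ 2)) @ \oo --> (0 : R).
  (* The square is the second moment with both factors started at h, at the diagonal index (a,
     a). *)
  under eq_fun do
    rewrite -(iter_deflated_hexpect _ _ _ p1 (or_introl h0)).
  exact: H.
split.
- have -> : (fun k => expect p w eps E k z0
      (fun z => sqnorm (xpart z - const_mx xa))) =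
    (fun k => \sum_i hexpect k (fun t => traj t h (lshift n i) 0 ^+ 2)).
    apply/funext => k; rewrite expectE -hexpect_sum; apply: eq_hexpect => t.
    apply: eq_bigr => i _; rewrite trh xav /xpart linearD /= col_mxKu addrK.
    by rewrite mxE.
  by apply: cvg0_sum => i; exact: null.
- have -> : (fun k => expect p w eps E k z0 (fun z => sqnorm (spart z))) =
    (fun k => \sum_i hexpect k (fun t => traj t h (rshift n i) 0 ^+ 2)).
    apply/funext => k; rewrite expectE -hexpect_sum; apply: eq_hexpect => t.
    apply: eq_bigr => i _; rewrite trh xav /spart linearD /= col_mxKd addr0.
    by rewrite mxE.
  by apply: cvg0_sum => i; exact: null.
Qed.

(** * From consensus to the spectral condition *)

Definition ms_null z :=
  (fun k => hexpect k (fun t => sqnorm (traj t z))) @ \oo --> (0 : R).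

Hypothesis n_gt1 : (1 < n)%N.
Hypothesis noloop : forall e, e \in E -> e.1 != e.2.
Hypothesis p_pos : forall e, e \in E -> 0 < p e.2 e.1 < 1.
Hypothesis p_sum : \sum_(e in E) p e.2 e.1 = 1.
Hypothesis w_pos : forall e, e \in E -> 0 < w e.2 e.1 < 1.

Lemma sqnorm_ge0 m (z : 'cV[R]_m) : 0 <= sqnorm z.
Proof. by apply: sumr_ge0 => i _; exact: sqr_ge0. Qed.

Lemma sqr_le_sqnorm m (z : 'cV[R]_m) a : z a 0 ^+ 2 <= sqnorm z.
Proof.
by rewrite /sqnorm (bigD1 a) //= lerDl sumr_ge0 // => i _; exact: sqr_ge0.
Qed.

Lemma sqnormZ m c (z : 'cV[R]_m) : sqnorm (c *: z) = c ^+ 2 * sqnorm z.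
Proof.
by rewrite /sqnorm mulr_sumr; apply: eq_bigr => i _; rewrite mxE exprMn.
Qed.

Lemma sqnormD_le m (z y : 'cV[R]_m) : sqnorm (z + y) <= 2 * sqnorm z + 2 * sqnorm y.
Proof.
rewrite /sqnorm !mulr_sumr -big_split /=; apply: ler_sum => i _; rewrite mxE.
by have := sqr_ge0 (z i 0 - y i 0); lra.
Qed.

Lemma ms_nullZ c z : ms_null z -> ms_null (c *: z).
Proof.
move=> z0; rewrite /ms_null.
have -> : (fun k => hexpect k (fun t => sqnorm (traj t (c *: z)))) =
    (fun k => c ^+ 2 * hexpect k (fun t => sqnorm (traj t z))).
  apply/funext => k; rewrite -hexpectZ; apply: eq_hexpect => t.
  by rewrite trajZ sqnormZ.
exact: cvg0Ml.
Qed.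

Lemma ms_nullD z y : ms_null z -> ms_null y -> ms_null (z + y).
Proof.
move=> z0 y0.
apply: (@cvg0_le _ _ (fun k => 2 * hexpect k (fun t => sqnorm (traj t z))
                             + 2 * hexpect k (fun t => sqnorm (traj t y)))).
  move=> k; rewrite ger0_norm; last by apply: hexpect_ge0 => // t; exact: sqnorm_ge0.
  rewrite -!hexpectZ -hexpectD; apply: hexpect_le => // t _.
  by rewrite trajD; exact: sqnormD_le.
by have := cvgD (cvg0Ml 2 z0) (cvg0Ml 2 y0); rewrite addr0; apply.
Qed.

Lemma ms_null_sum (I : Type) (s : seq I) (f : I -> 'cV[R]_(n + n)) :
  (forall i, ms_null (f i)) -> ms_null (\sum_(i <- s) f i).
Proof.
move=> f0; elim: s => [|i s IH]; last by rewrite big_cons; exact: ms_nullD.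
rewrite big_nil /ms_null.
have -> : (fun k => hexpect k (fun t => sqnorm (traj t 0))) = (fun=> 0).
  apply/funext => k; apply: big1 => t _.
  by rewrite -[X in traj _ X](scale0r 0) trajZ sqnormZ expr0n mul0r mulr0.
exact: cvg_cst.
Qed.

(** The edge e comes first with positive probability, so the second moment at time k from M e z is
    at most 1/p times the one at time k + 1 from z. *)
Lemma ms_null_Mmx e z : e \in E -> ms_null z -> ms_null (M e *m z).
Proof.
move=> eE z0; have /andP[pe _] := p_pos eE.
apply: (@cvg0_le _ _ (fun k => (p e.2 e.1)^-1 *
   hexpect k.+1 (fun t => sqnorm (traj t z)))).
  move=> k; rewrite ger0_norm; last by apply: hexpect_ge0 => // t; exact: sqnorm_ge0.
  rewrite hexpectS (bigD1 e) //= mulrDr mulKf ?gt_eqF // lerDl.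
  rewrite mulr_ge0 ?invr_ge0 ?(ltW pe) //.
  apply: sumr_ge0 => f /andP[/p_pos/andP[/ltW pf _] _].
  by rewrite mulr_ge0 // hexpect_ge0 // => t; exact: sqnorm_ge0.
by apply: cvg0Ml; have := z0; rewrite /ms_null -cvg_shiftS; apply.
Qed.

Lemma consensus_ms_null (x : 'cV[R]_n) :
  ms_average_consensus p w eps E -> \sum_i x i 0 = 0 -> ms_null (col_mx x 0).
Proof.
move=> /(_ x) /=; rewrite /ms_null => H x0; move: H.
rewrite x0 mul0r => -[H1 H2].
have -> : (fun k => hexpect k (fun t => sqnorm (traj t (col_mx x 0)))) =
   (fun k => expect p w eps E k (col_mx x 0) (fun z => sqnorm (xpart z - const_mx 0))
           + expect p w eps E k (col_mx x 0) (fun z => sqnorm (spart z))).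
  apply/funext => k; rewrite !expectE -hexpectD; apply: eq_hexpect => t.
  rewrite /sqnorm big_split_ord /=.
  by congr (_ + _); apply: eq_bigr => i _; rewrite !mxE ?subr0.
by have := cvgD H1 H2; rewrite addr0; apply.
Qed.

(** The projection of f_i onto the zero-sum vectors, for which the target average x_a is 0. *)
Definition centered (i : 'I_n) : 'cV[R]_n := delta_mx i 0 - const_mx n%:R^-1.

Lemma sum_centered i : \sum_a centered i a 0 = 0.
Proof.
have nz : n%:R != 0 :> R by rewrite pnatr_eq0 -lt0n ltnW.
under eq_bigr do rewrite !mxE.
rewrite sumrB sumr_const card_ord (bigD1 i) //= big1 => [|a ai].
  by rewrite !eqxx addr0 -[X in _ - X]mulr_natr mulVf // subrr.
by rewrite (negPf ai).
Qed.

(* Without an incoming edge the state x_i would be frozen at its initial value. *)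
Lemma consensus_in_edge i :
  ms_average_consensus p w eps E -> exists j, (j, i) \in E.
Proof.
move=> /consensus_ms_null /(_ (sum_centered i)) H.
apply/existsP; apply: contraPT H; rewrite negb_exists => /forallP noin.
have frozen t z : all (fun e => e \in E) t ->
    traj t z (lshift n i) 0 = z (lshift n i) 0.
  elim: t z => //= e t IH z /andP[eE tE]; rewrite IH //.
  have ei : e.2 != i by apply: contraTneq eE => ei; have := noin e.1;
    rewrite -ei -surjective_pairing.
  rewrite -[z]vsubmxK Mmx_mul_col Lmx_mul_col Dmx_mul_col !col_mxEu !mxE.
  by rewrite eq_sym (negPf ei) !mulr0 subr0 addr0.
have c0 : 0 < (1 - n%:R^-1) ^+ 2 :> R.
  rewrite exprn_gt0 // subr_gt0 invf_lt1 ?ltr1n // ltr0n; exact: ltnW.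
move=> /cvgr0Pnorm_lt /(_ _ c0) [N _ /(_ N (leqnn N))] /=.
rewrite ger0_norm; last by apply: hexpect_ge0 => // t; exact: sqnorm_ge0.
apply/negP; rewrite -leNgt -[X in X <= _](hexpect_cst p_sum N).
apply: hexpect_le => // t tE; apply: le_trans (sqr_le_sqnorm _ (lshift n i)).
by rewrite frozen // col_mxEu !mxE !eqxx.
Qed.

(* The hypothesis only covers s(0) = 0; a first step along an edge (j, i) turns
   (x, 0) into (x - s, s) with s a multiple of f_i, so linearity gives every
   zero-sum initial state. *)
Lemma consensus_ms_null_zero_sum (z : 'cV[R]_(n + n)) :
  ms_average_consensus p w eps E -> \sum_i z i 0 = 0 -> ms_null z.
Proof.
move=> H; rewrite -[z]vsubmxK; set x := usubmx z; set s := dsubmx z.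
rewrite big_split_ord /=.
under eq_bigr do rewrite col_mxEu.
under [X in _ + X]eq_bigr do rewrite col_mxEd.
move=> xs.
(* Entries i and j of [centered i] differ by 1 because j differs from i. So the edge (j, i) changes
   the state ([centered i], 0) by w_ij (-f_i, f_i), and dividing this increment by w_ij gives the
   claim. *)
have transfer i : ms_null (col_mx (- delta_mx i 0) (delta_mx i 0)).
  have [j jE] := consensus_in_edge i H.
  have wp : 0 < w i j by have /andP[] := w_pos jE.
  have ji : (j == i) = false by apply/negbTE; exact: noloop jE.
  have N0 := consensus_ms_null H (sum_centered i).
  have := ms_nullZ (w i j)^-1 (ms_nullD (ms_null_Mmx jE N0) (ms_nullZ (-1) N0)).
  congr ms_null; rewrite Mmx_mul_col Lmx_mul_col /= !mulmx0 !mxE !eqxx ji.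
  rewrite scaleN1r opp_col_mx oppr0 scaler0 !addr0 sub0r opprK subrK mulr1.
  rewrite add_col_mx addr0 addrAC subrr add0r scale_col_mx scalerN.
  by rewrite scalerA mulVf ?gt_eqF // scale1r.
have -> : col_mx x s = col_mx (x + s) 0
    + \sum_i s i 0 *: col_mx (- delta_mx i 0) (delta_mx i 0).
  have S : \sum_i s i 0 *: delta_mx i 0 = s.
    by rewrite [RHS]matrix_sum_delta; apply: eq_bigr => i _; rewrite big_ord1.
  under eq_bigr do rewrite scale_col_mx scalerN.
  have -> : \sum_i col_mx (- (s i 0 *: delta_mx i 0)) (s i 0 *: delta_mx i 0)
      = col_mx (- s) s.
    rewrite -[in RHS]S -sumrN; elim/big_rec3: _ => [|i a b c _ ->].
      by rewrite col_mx0.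
    by rewrite add_col_mx.
  by rewrite add_col_mx addrK add0r.
apply: ms_nullD.
  apply: consensus_ms_null => //.
  by under eq_bigr do rewrite mxE; rewrite big_split.
by apply: ms_null_sum => i; exact: ms_nullZ.
Qed.

Lemma ms_null_cross z y a b : ms_null z -> ms_null y ->
  (fun k => hexpect k (fun t => traj t z a 0 * traj t y b 0)) @ \oo --> (0 : R).
Proof.
move=> z0 y0.
apply: (@cvg0_le _ _ (fun k => hexpect k (fun t => sqnorm (traj t z))
                             + hexpect k (fun t => sqnorm (traj t y)))).
  move=> k; rewrite -hexpectD ler_norml -mulN1r -hexpectZ.
  apply/andP; split; apply: hexpect_le => // t _;
    have := sqr_le_sqnorm (traj t z) a; have := sqr_le_sqnorm (traj t y) b;
    have := sqr_ge0 (traj t z a 0 + traj t y b 0);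
    have := sqr_ge0 (traj t z a 0 - traj t y b 0);
    have := sqr_ge0 (traj t z a 0); have := sqr_ge0 (traj t y b 0); lra.
by have := cvgD z0 y0; rewrite addr0; apply.
Qed.

Lemma ms_null_mean z a : ms_null z ->
  (fun k => hexpect k (fun t => traj t z a 0)) @ \oo --> (0 : R).
Proof.
move=> z0; apply/cvgr0Pnorm_lt => e e0.
(* The threshold is e^2 because Jensen bounds the square of the mean by the second moment. *)
have e20 : 0 < e ^+ 2 by rewrite exprn_gt0.
move/cvgr0Pnorm_lt: z0 => /(_ _ e20); apply: filterS => k.
rewrite ger0_norm; last by apply: hexpect_ge0 => // t; exact: sqnorm_ge0.
move=> Q; rewrite -(ltr_pXn2r (n := 2)) ?nnegrE ?(ltW e0) // real_normK ?num_real //.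
apply: le_lt_trans Q; apply: (le_trans (sqr_hexpect_le p_pos p_sum _ _)).
by apply: hexpect_le => // t _; exact: sqr_le_sqnorm.
Qed.

Lemma consensus_spectrum :
  ms_average_consensus p w eps E -> simple_one_rest_in_disk A.
Proof.
move=> H; apply/simple_one_iter_deflated => //; first exact: ltnW.
have nz : n%:R != 0 :> R by rewrite pnatr_eq0 -lt0n ltnW.
pose null (u : 'cV[R]_((n + n) * (n + n))) :=
  forall i, (fun k => iter k (mulmx B) u i 0) @ \oo --> (0 : R).
have nullD u1 u2 : null u1 -> null u2 -> null (u1 + u2).
  move=> h1 h2 i; have := cvgD (h1 i) (h2 i); rewrite addr0.
  by under [in X in _ -> X]eq_fun do rewrite iter_mulmx mulmxDr -!iter_mulmx mxE; apply.
have nullZ c u : null u -> null (c *: u).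
  move=> h i; have := cvg0Ml c (h i).
  by under [in X in _ -> X]eq_fun do rewrite iter_mulmx -scalemxAr -iter_mulmx mxE; apply.
have nullzz (z y : 'cV[R]_(n + n)) : \sum_i z i 0 = 0 -> \sum_i y i 0 = 0 -> null (tens_col z y).
  move=> z0 y0 i; case: (mxtens_indexP i) => a b.
  under eq_fun do rewrite (iter_deflated_hexpect _ _ _ p_sum (or_introl z0)).
  by apply: ms_null_cross; apply: consensus_ms_null_zero_sum.
have nullzv (z : 'cV[R]_(n + n)) : \sum_i z i 0 = 0 -> null (tens_col z v).
  move=> z0 i; case: (mxtens_indexP i) => a b.
  under eq_fun do rewrite (iter_deflated_hexpect _ _ _ p_sum (or_introl z0)).
  (* The v factor stays constant in time, so the cross moment is a constant times the mean of an
     entry of z. *)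
  under eq_fun => k do under eq_hexpect do rewrite traj_consensus mulrC.
  under eq_fun do rewrite hexpectZ.
  by apply: cvg0Ml; apply: ms_null_mean; apply: consensus_ms_null_zero_sum.
have nullvz (z : 'cV[R]_(n + n)) : \sum_i z i 0 = 0 -> null (tens_col v z).
  move=> z0 i; case: (mxtens_indexP i) => a b.
  under eq_fun do rewrite (iter_deflated_hexpect _ _ _ p_sum (or_intror z0)).
  under eq_fun => k do under eq_hexpect do rewrite traj_consensus.
  under eq_fun do rewrite hexpectZ.
  by apply: cvg0Ml; apply: ms_null_mean; apply: consensus_ms_null_zero_sum.
have nullvv : null (tens_col v v).
  have B0 : B *m tens_col v v = 0.
    rewrite mulmxBl EMkronM_consensus // -mulmxA mul_ones_tens_col.
    rewrite sum_consensus_dir mul_mx_scalar scalerA -expr2 mulfV ?scale1r ?subrr //.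
    by rewrite sqrf_eq0.
  (* The iterates vanish only from k = 1 on, hence the shift. *)
  move=> i; rewrite -cvg_shiftS /=.
  have -> : (fun k => iter k.+1 (mulmx B) (tens_col v v) i 0) = (fun=> 0).
    by apply/funext => k; rewrite iterSr B0 iter_mulmx mulmx0 mxE.
  exact: cvg_cst.
have null_tens z y : null (tens_col z y).
  have split_sum (x : 'cV[R]_(n + n)) : exists h c,
      x = h + c *: v /\ \sum_i h i 0 = 0.
    pose c := (\sum_i x i 0) / n%:R.
    exists (x - c *: v), c; split; first by rewrite subrK.
    by rewrite sum_sub_consensus /c divfK // subrr.
  (* Splitting both factors into a zero-sum part and a multiple of v, bilinearity leaves the four
     cases above. *)
  have [h [c [-> h0]]] := split_sum z; have [g [d [-> g0]]] := split_sum y.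
  rewrite tens_colDl !tens_colDr !tens_colZl !tens_colZr.
  apply: (nullD); apply: (nullD); do ?[apply: (nullZ)];
    [exact: nullzz|exact: nullzv|exact: nullvz|exact: nullvv].
move=> u; rewrite [u]matrix_sum_delta.
elim/big_ind: _ => [i|u1 u2 h1 h2|c _].
- have -> : (fun k => iter k (mulmx B) (0 : 'cV[R]_((n + n) * (n + n))) i 0) =
      (fun=> 0).
    by apply/funext => k; rewrite iter_mulmx mulmx0 mxE.
  exact: cvg_cst.
- exact: nullD.
- rewrite big_ord1; apply: (nullZ); case: (mxtens_indexP c) => a b.
  (* Every standard basis vector of the product space is a tensor of basis vectors. *)
  have -> : delta_mx (mxtens_index (a, b)) 0 =
      tens_col (delta_mx a 0) (delta_mx b 0) :> 'cV[R]_((n + n) * (n + n)).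
    apply/colP => d; case: (mxtens_indexP d) => a' b'.
    rewrite tens_colE !mxE !eqxx !andbT -natrM mulnb.
    by rewrite (can_eq (@mxtens_indexK _ _)) xpair_eqE.
  exact: null_tens.
Qed.

End Gossip.

Theorem proposition3 (R : realType) (n : nat) (E : {set 'I_n * 'I_n})
  (p w : 'I_n -> 'I_n -> R) (eps : R) :
  (1 < n)%N ->
  (forall e, e \in E -> e.1 != e.2) ->
  (forall e, e \in E -> 0 < p e.2 e.1 < 1) ->
  \sum_(e in E) p e.2 e.1 = 1 ->
  (forall e, e \in E -> 0 < w e.2 e.1 < 1) ->
  0 < eps ->
  ms_average_consensus p w eps E <->
  simple_one_rest_in_disk (EMkronM p w eps E).
Proof.
move=> n1 noloop p_pos p_sum w_pos _; split; first exact: consensus_spectrum.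
by apply: spectrum_consensus => //; exact: ltnW.
Qed.
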